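(* Let $\mathcal{A}$ be an algebra over $\mathbb{C}$, let $q\in\mathbb{C}-\{0\}$, and let $A_1, A_2,\dots,A_k$ be $2$-by-$2$ matrices with coefficients in $\mathcal{A}$ such that: (1) each $A_i$ is triangular of the form $\begin{pmatrix} a_i & b_i\\ 0& a_i^{-1}\end{pmatrix}$ or $\begin{pmatrix} a_i & 0\\ b_i& a_i^{-1}\end{pmatrix}$, where $a_i,b_i\in\mathcal{A}$, $a_i$ is invertible in $\mathcal{A}$, and $b_ia_i=q\,a_ib_i$; (2) $a_i$ and $b_i$ commute with $a_j$ and $b_j$ whenever $i\neq j$. Then, if $q^2$ is a primitive $n$-root of unity, $$T_n(\mathrm{Trace}\, A_1A_2\cdots A_k)=\mathrm{Trace}\, A_1^{(n)}A_2^{(n)}\cdots A_k^{(n)},$$ where each $A_i^{(n)}$ is obtained from $A_i$ by replacing $a_i$ and $b_i$ with their powers $a_i^n$ and $b_i^n$ (that is, $A_i^{(n)}=\begin{pmatrix} a_i^n & b_i^n\\ 0& a_i^{-n}\end{pmatrix}$ or $\begin{pmatrix} a_i^n & 0\\ b_i^n& a_i^{-n}\end{pmatrix}$, respectively).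
   Context: Algebras are associative and unital, not necessarily commutative. The same number $q$ is used for all indices $i$. Products of $2$-by-$2$ matrices over $\mathcal{A}$ are given by the usual formula, and the trace of $\begin{pmatrix} a&b\\c&d\end{pmatrix}$ is $a+d\in\mathcal{A}$. A primitive $n$-root of unity is a $\zeta\in\mathbb{C}$ with $\zeta^n=1$ and $\zeta^k\neq1$ for $0<k<n$. The (normalized) Chebyshev polynomials of the first kind $T_n(t)\in\mathbb{Z}[t]$ are defined by $T_0(t)=2$, $T_1(t)=t$ and $T_{n+1}(t)=t\,T_n(t)-T_{n-1}(t)$; equivalently, $\mathrm{Trace}\,A^n=T_n(\mathrm{Trace}\,A)$ for every $A\in\mathrm{SL}_2(\mathbb{C})$. *)

(* Defs.v *)
From mathcomp Require Import all_boot all_order all_algebra.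
From mathcomp Require Import reals complex.

Set Implicit Arguments.
Unset Strict Implicit.
Unset Printing Implicit Defensive.

Import Order.TTheory GRing.Theory Num.Theory.

Local Open Scope ring_scope.

(* Normalized so that T_0 = 2 and T_1 = t (and not T_0 = 1, T_2 = 2 t^2 - 1). *)
Fixpoint chebT (n : nat) : {poly int} :=
  match n with
  | 0%N => 2
  | n1.+1 =>
      match n1 with
      | 0%N => 'X
      | n2.+1 => 'X * chebT n1 - chebT n2
      end
  end.

(* [A] need not be commutative; integers are central in it, so that the Horner
   evaluation below is the usual substitution. *)
Definition cheb_eval (A : nzRingType) (n : nat) (x : A) : A :=
  (map_poly intr (chebT n)).[x].

Definition mx2 (A : nzRingType) (a b c d : A) : 'M[A]_2 :=
  \matrix_(i < 2, j < 2)
    if i == 0 then (if j == 0 then a else b) else (if j == 0 then c else d).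

(* The argument [a'] stands for the inverse of [a]: a general algebra carries no
   inverse operation, so the inverse is passed explicitly. *)
Definition triang (A : nzRingType) (upper : bool) (a a' b : A) : 'M[A]_2 :=
  if upper then mx2 a b 0 a' else mx2 a 0 b a'.

Definition mutually_inverse (A : nzRingType) (a a' : A) : Prop :=
  a * a' = 1 /\ a' * a = 1.

(* Main.v *)
(* The triangular matrices are points of the quantum group SL_2^q, and a product
   of points with commuting entries is again one. In an entry of such a product,
   a sum x + y with y x = q^2 x y, the n-th power is additive, so raising the
   entries to the n-th power is multiplicative. It remains to see that
   T_n(a + d) = a^n + d^n for a point (a, b; c, d).

   Put t = a + d and z = b c. The powers of a and of d satisfy three-term
   recursions whose coefficients act by t on the left and by z on the right.
   These two actions commute, so the recursions are governed by products of
   2x2 transfer matrices over F[tau, X]. The recursion for d runs through the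
   same matrices in the opposite order, which gives a^n + d^n = tr M with
   M = N(q u^(n-1)) ... N(q) and u = q^2. By cyclicity of the trace, tr M is
   invariant under X -> u X; as its degree in X is less than n, it does not
   depend on X, and at X = 0 it is T_n(tau). *)

Require Import Defs.
From mathcomp Require Import all_boot all_order all_algebra.
From mathcomp Require Import reals complex.
From mathcomp Require Import ring zify.

Set Implicit Arguments.
Unset Strict Implicit.
Unset Printing Implicit Defensive.

Import Order.TTheory GRing.Theory Num.Theory.

Local Open Scope ring_scope.

(** * Roots of unity and the factorization of a^n - b^n *)

Lemma prim_root_rmorph (R S : nzRingType) (f : {rmorphism R -> S}) n u :
  injective f -> n.-primitive_root u -> n.-primitive_root (f u).
Proof.
move=> f_inj /andP[n_gt0 /forallP hu]; apply/andP; split=> //.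
apply/forallP => i; have := hu i.
by rewrite !unity_rootE -rmorphXn -(rmorph1 f) (inj_eq f_inj).
Qed.

(** For b nonzero, this is the factorization of X^n - 1 evaluated at a / b and multiplied by b^n. *)
Lemma prod_subr_root (K : fieldType) (n : nat) (u : K) (a b : K) :
  n.-primitive_root u -> \prod_(i < n) (a - u ^+ i * b) = a ^+ n - b ^+ n.
Proof.
move=> hu; have n_gt0 := prim_order_gt0 hu.
have [-> | b0] := eqVneq b 0.
  under eq_bigr do rewrite mulr0 subr0.
  by rewrite prodr_const card_ord expr0n gtn_eqF // subr0.
have := congr1 (fun p : {poly K} => b ^+ n * p.[a / b]) (factor_Xn_sub_1 hu).
rewrite big_mkord horner_prod !hornerE /= mulrBr mulr1 expr_div_n mulrCA divff ?expf_neq0 // mulr1.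
move=> <-; rewrite -[in b ^+ n](card_ord n) -prodr_const -big_split /=.
by apply: eq_bigr => i _; rewrite !hornerE mulrBr mulrCA divff // mulr1 mulrC [b * _]mulrC.
Qed.

Lemma prod_subr_root_idomain (R : idomainType) (n : nat) (u : R) (a b : R) :
  n.-primitive_root u -> \prod_(i < n) (a - u ^+ i * b) = a ^+ n - b ^+ n.
Proof.
move=> hu; apply/eqP; rewrite -tofrac_eq; apply/eqP.
have hu' : n.-primitive_root (tofrac u).
  apply: prim_root_rmorph hu => x y /eqP.
  by rewrite tofrac_eq => /eqP.
rewrite rmorph_prod rmorphB !rmorphXn /= -(prod_subr_root _ _ hu').
by apply: eq_bigr => i _; rewrite rmorphB rmorphM rmorphXn.
Qed.

(** * The two-sided polynomial action and additivity of the n-th power *)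

Section TwoSided.
Variables (F : fieldType) (A : algType F).

(* The commutative ring [F[tau][X]] acts on [A]: [tau] multiplies by [t] on the
   left and ['X] multiplies by [z] on the right. *)
Definition bimul (t z : A) (P : {poly {poly F}}) (x : A) : A :=
  (map_poly (horner_alg t) P * x%:P).[z].

Variables (t z : A).
Implicit Types (P Q : {poly {poly F}}) (x : A).
Local Notation ev := (bimul t z).

Lemma bimulDl P Q x : ev (P + Q) x = ev P x + ev Q x.
Proof. by rewrite /bimul rmorphD mulrDl hornerD. Qed.

Lemma bimulNl P x : ev (- P) x = - ev P x.
Proof. by rewrite /bimul rmorphN mulNr hornerN. Qed.

Lemma bimul0 x : ev 0 x = 0.
Proof. by rewrite /bimul rmorph0 mul0r horner0. Qed.

Lemma bimul1 x : ev 1 x = x.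
Proof. by rewrite /bimul rmorph1 mul1r hornerC. Qed.

Lemma bimul_tau P x : ev ('X%:P * P) x = t * ev P x.
Proof. by rewrite /bimul rmorphM /= map_polyC /= horner_algX -mulrA hornerCM. Qed.

Lemma bimulX P x : ev ('X * P) x = ev P x * z.
Proof.
by rewrite /bimul rmorphM /= map_polyX -mulrA -(commr_polyX (_ * _)) hornerMX.
Qed.

Lemma bimulZ (c : F) P x : ev (c%:P%:P * P) x = c *: ev P x.
Proof.
by rewrite /bimul rmorphM /= map_polyC /= horner_algC -mulrA hornerCM -scalerAl mul1r.
Qed.

Lemma bimul_const (p : {poly F}) : ev p%:P 1 = horner_alg t p.
Proof. by rewrite /bimul map_polyC mulr1 hornerC. Qed.

End TwoSided.

Lemma qcomm_expr (F : fieldType) (A : algType F) (u : F) (k : nat) (x y : A) :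
  y * x = u *: (x * y) -> y * x ^+ k = u ^+ k *: (x ^+ k * y).
Proof.
move=> yx; elim: k => [|k IH]; first by rewrite !expr0 mulr1 mul1r scale1r.
by rewrite exprS mulrA yx -scalerAl -[x * y * _]mulrA IH -scalerAr scalerA mulrA -!exprS.
Qed.

(* With s = x + y one has x^(k+1) = s x^k - x^k (u^k y), and left multiplication
   by s commutes with right multiplication by y, so x^n is the action on 1 of
   prod_i (tau - u^i X) = tau^n - X^n. *)
Lemma exprD_qcomm (F : fieldType) (A : algType F) (u : F) (n : nat) (x y : A) :
  n.-primitive_root u -> y * x = u *: (x * y) ->
  (x + y) ^+ n = x ^+ n + y ^+ n.
Proof.
move=> hu yx.
have yxn k := qcomm_expr k yx.
have xE k : bimul (x + y) y (\prod_(i < k) ('X%:P - u%:P%:P ^+ i * 'X)) 1 = x ^+ k.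
  elim: k => [|k IH]; first by rewrite big_ord0 bimul1.
  rewrite big_ord_recr /= mulrC mulrBl bimulDl bimulNl bimul_tau -rmorphXn -rmorphXn /=.
  by rewrite -mulrA bimulZ bimulX IH mulrDl yxn addrK exprS.
have tauE k P : bimul (x + y) y ('X%:P ^+ k * P) 1 = (x + y) ^+ k * bimul (x + y) y P 1.
  elim: k => [|k IH]; first by rewrite !expr0 !mul1r.
  by rewrite !exprS -!mulrA bimul_tau IH.
have XE k : bimul (x + y) y ('X ^+ k) 1 = y ^+ k.
  elim: k => [|k IH]; first by rewrite !expr0 bimul1.
  by rewrite exprS bimulX IH exprSr.
have hu' : n.-primitive_root (u%:P%:P : {poly {poly F}}).
  by do 2!apply: (prim_root_rmorph (@polyC_inj _)).
have := xE n; rewrite (prod_subr_root_idomain _ _ hu') bimulDl bimulNl XE.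
by rewrite -['X%:P ^+ n]mulr1 tauE bimul1 mulr1 => <-; rewrite subrK.
Qed.

(** * Two-by-two matrices over a noncommutative ring *)

Section Mx2.
Variable (A : nzRingType).
Implicit Types a b c d : A.

Lemma mx2E a b c d :
  (mx2 a b c d 0 0 = a) * (mx2 a b c d 0 1 = b) *
  (mx2 a b c d 1 0 = c) * (mx2 a b c d 1 1 = d).
Proof. by rewrite /mx2 !mxE. Qed.

Lemma mx2_eta (M : 'M[A]_2) : M = mx2 (M 0 0) (M 0 1) (M 1 0) (M 1 1).
Proof.
have i2 (i : 'I_2) : i = if i == 0 then 0 else 1.
  by case: i => [[|[|]]] // lti; apply/val_inj.
by apply/matrixP => i j; rewrite [RHS]mxE {1}(i2 i) {1}(i2 j); do 2!case: ifP.
Qed.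

Lemma mx2M_entries (M N : 'M[A]_2) (i j : 'I_2) :
  (M * N) i j = M i 0 * N 0 j + M i 1 * N 1 j.
Proof.
have l01 : lift ord0 ord0 = 1 :> 'I_2 by apply/val_inj.
by rewrite -mulmxE mxE !big_ord_recl big_ord0 addr0 l01.
Qed.

Lemma mx2M a b c d a' b' c' d' :
  mx2 a b c d * mx2 a' b' c' d' =
  mx2 (a * a' + b * c') (a * b' + b * d') (c * a' + d * c') (c * b' + d * d').
Proof.
by rewrite [LHS]mx2_eta !mx2M_entries !mx2E.
Qed.

Lemma mx2_1 : 1 = mx2 1 0 0 1 :> 'M[A]_2.
Proof. by rewrite [LHS]mx2_eta !mxE. Qed.

Lemma mxtrace_mx2 a b c d : \tr (mx2 a b c d) = a + d.
Proof.
have l01 : lift ord0 ord0 = 1 :> 'I_2 by apply/val_inj.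
by rewrite /mxtrace !big_ord_recl big_ord0 addr0 l01 !mx2E.
Qed.

Lemma mxtrace2 (M : 'M[A]_2) : \tr M = M 0 0 + M 1 1.
Proof. by rewrite [M in LHS]mx2_eta mxtrace_mx2. Qed.

End Mx2.

(** * Chebyshev polynomials as traces of powers *)

Lemma cheb_eval0 (A : nzRingType) (x : A) : cheb_eval 0 x = 2.
Proof. by rewrite /cheb_eval rmorph_nat hornerMn hornerC. Qed.

Lemma cheb_eval1 (A : nzRingType) (x : A) : cheb_eval 1 x = x.
Proof. by rewrite /cheb_eval map_polyX hornerX. Qed.

Lemma cheb_evalSS (A : nzRingType) (n : nat) (x : A) :
  cheb_eval n.+2 x = cheb_eval n.+1 x * x - cheb_eval n x.
Proof.
have -> : cheb_eval n.+2 x = (map_poly intr (chebT n.+1 * 'X - chebT n)).[x].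
  by rewrite [chebT n.+1 * 'X]mulrC.
rewrite /cheb_eval; move: (chebT n.+1) (chebT n) => p r.
by rewrite rmorphB rmorphM /= map_polyX hornerD hornerN hornerMX.
Qed.

Lemma rmorph_cheb (A B : nzRingType) (f : {rmorphism A -> B}) n x :
  f (cheb_eval n x) = cheb_eval n (f x).
Proof.
suff: f (cheb_eval n x) = cheb_eval n (f x) /\
      f (cheb_eval n.+1 x) = cheb_eval n.+1 (f x) by case.
elim: n => [|n [IH0 IH1]]; first by rewrite !cheb_eval0 !cheb_eval1 rmorph_nat.
by split=> //; rewrite !cheb_evalSS rmorphB rmorphM IH0 IH1.
Qed.

(** By Cayley-Hamilton this companion matrix satisfies C^2 = x C - 1, so the traces of its powers
    obey the Chebyshev recursion. *)
Lemma mxtrace_SL2_exp (R : comNzRingType) (x : R) n :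
  \tr (mx2 x (-1) 1 0 ^+ n) = cheb_eval n x.
Proof.
have sq : mx2 x (-1) 1 0 ^+ 2 = x *: mx2 x (-1) 1 0 - 1 :> 'M_2.
  rewrite expr2 mx2M mx2_1 [RHS]mx2_eta !mxE /=.
  by congr mx2; ring.
suff: \tr (mx2 x (-1) 1 0 ^+ n) = cheb_eval n x /\
      \tr (mx2 x (-1) 1 0 ^+ n.+1) = cheb_eval n.+1 x by case.
elim: n => [|n [IH0 IH1]].
  by rewrite expr0 expr1 mxtrace1 mxtrace_mx2 addr0 cheb_eval0 cheb_eval1.
split=> //; rewrite cheb_evalSS 2!exprS mulrA -expr2 sq mulrBl mul1r.
rewrite -scalerAl -exprS.
by rewrite raddfB /= mxtraceZ IH0 IH1 mulrC.
Qed.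

(** * Traces of products of transfer matrices *)

(** Comparing coefficients gives (u^i - 1) p_i = 0, and u^i differs from 1 for 0 < i < n. *)
Lemma comp_poly_scaleX_invariant (R : idomainType) (n : nat) (u : R)
    (p : {poly R}) :
  n.-primitive_root u -> (size p <= n)%N -> p \Po (u *: 'X) = p ->
  p = (p`_0)%:P.
Proof.
move=> hu sp pE; apply/polyP => i; rewrite coefC; case: eqP => [-> //|/eqP i0].
have [ltin | leni] := ltnP i n; last by rewrite nth_default // (leq_trans sp).
have : (p \Po (u *: 'X))`_i = u ^+ i * p`_i.
  rewrite comp_polyE (_ : \sum_(_ < _) _ = \poly_(j < size p) (u ^+ j * p`_j)).
    by rewrite coef_poly; case: ltnP => // le_pi; rewrite nth_default ?mulr0.
  by rewrite poly_def; apply: eq_bigr => j _; rewrite exprZn scalerA mulrC.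
rewrite pE => /eqP; rewrite -subr_eq0 -{1}[p`_i]mul1r -mulrBl mulf_eq0.
rewrite subr_eq0 eq_sym -(prim_order_dvd hu) gtnNdvd ?lt0n //=.
exact: eqP.
Qed.

(* Powers of the diagonal entries of a quantum SL_2 matrix satisfy the recursion
   e_(j+1) = t e_j - e_(j-1) (1 + c_j z), of which this is the step matrix. *)
Definition transfer (F : fieldType) (c : F) : 'M[{poly {poly F}}]_2 :=
  mx2 'X%:P (- (1 + c%:P%:P * 'X)) 1 0.

(** The variable X occurs only in the upper right entry, where it multiplies the lower row of the
    remaining product. That row is the upper row of a product shorter by one more factor, so the
    degree in X grows by at most one for every two factors. *)
Lemma size_prod_transfer (F : fieldType) (c : nat -> F) k (j : 'I_2) :
  let M := \prod_(i < k) transfer (c i) in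
  (size (M 0%R j) <= (uphalf k).+1)%N && (size (M 1%R j) <= (k./2).+1)%N.
Proof.
elim: k c => [|k IH] c /=.
  by rewrite big_ord0 !mxE; do 2!case: eqP => _; rewrite ?size_poly1 ?size_poly0.
rewrite big_ord_recl !mx2M_entries !mx2E mul1r mul0r addr0.
have /andP[s0 s1] := IH (fun i => c i.+1); move: s0 s1.
set M := \prod_(_ < _) _ => s0 s1; rewrite s0 andbT mulNr.
apply: leq_trans (size_polyD _ _) _; rewrite geq_max size_polyN; apply/andP; split.
  rewrite mul_polyC (leq_trans (size_scale_leq _ _)) // (leq_trans s0) //.
  by rewrite ltnS uphalf_half; case: odd; rewrite ?leqnSn.
apply: leq_trans (size_polyMleq _ _) _.
have : (size (1 + (c 0)%:P%:P * 'X : {poly {poly F}})%R <= 2)%N.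
  rewrite (leq_trans (size_polyD _ _)) // geq_max size_poly1 /= mul_polyC.
  by rewrite (leq_trans (size_scale_leq _ _)) // size_polyX.
by move: s1; move: (size _) (size _) => ? ?; lia.
Qed.

Section TraceTransfer.
Variables (F : fieldType) (u : F) (n : nat).
Hypothesis hu : n.-primitive_root u.

(* Replacing X by u X permutes the factors cyclically. *)
Lemma mxtrace_transfer_invariant (c : F) :
  let T := \tr (\prod_(i < n) transfer (c * u ^+ (n.-1 - i))) in
  T \Po (u%:P *: 'X) = T.
Proof.
case: n hu => [|m] // hm /=.
pose s : {rmorphism _ -> _} := comp_poly (u%:P *: 'X : {poly {poly F}}).
have sN d : map_mx s (transfer d) = transfer (d * u).
  rewrite [LHS]mx2_eta !mxE /= /transfer; congr mx2.
  - by rewrite comp_polyC.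
  - rewrite rmorphN rmorphD rmorphM rmorph1 /= comp_polyX comp_polyC.
    by rewrite -mul_polyC mulrA !polyCM.
  - by rewrite rmorph1.
  - by rewrite rmorph0.
rewrite -[LHS]/(s _) -trace_map_mx rmorph_prod.
rewrite big_ord_recl big_ord_recr /= -!mulmxE mxtrace_mulC.
congr (\tr (_ *m _)).
  apply: eq_bigr => i _; rewrite sN -mulrA -exprSr.
  by congr (transfer (_ * _ ^+ _)); move: (ltn_ord i); rewrite /bump /=; lia.
(* The leading factor, of parameter c u^m, becomes c u^(m+1) = c, the parameter of the last one. *)
by rewrite sN subn0 subnn -mulrA -exprSr (prim_expr_order hm) expr0.
Qed.

Lemma mxtrace_prod_transfer (c : F) : (1 < n)%N ->
  \tr (\prod_(i < n) transfer (c * u ^+ (n.-1 - i))) = (cheb_eval n 'X)%:P.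
Proof.
move=> n_gt1.
have hu' := prim_root_rmorph (@polyC_inj _) hu.
rewrite [LHS](comp_poly_scaleX_invariant hu') ?mxtrace_transfer_invariant //.
  (* At X = 0 all factors become the same companion matrix of [mxtrace_SL2_exp]. *)
  congr _%:P; rewrite -horner_coef0 -[LHS]/(horner_eval 0 _) -trace_map_mx rmorph_prod /=.
  rewrite -mxtrace_SL2_exp -[in RHS](card_ord n) -prodr_const.
  congr (\tr _); apply: eq_bigr => i _.
  by rewrite [LHS]mx2_eta !mxE /= /horner_eval !hornerE.
rewrite mxtrace2 (leq_trans (size_polyD _ _)) // geq_max.
have /andP[s0 _] := size_prod_transfer (fun i => c * u ^+ (n.-1 - i)) n 0.
have /andP[_ s1] := size_prod_transfer (fun i => c * u ^+ (n.-1 - i)) n 1.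
move: s0 s1; set M := \prod_(_ < _) _; move=> s0 s1.
(* The bound (uphalf n) + 1 <= n requires n > 1; [cheb_eval_diag] settles n = 1 directly. *)
by apply/andP; split; [apply: leq_trans s0 _ | apply: leq_trans s1 _]; lia.
Qed.
End TraceTransfer.

(** * The Chebyshev identity for the diagonal entries *)

(** Here [z] stands for the product of the off-diagonal entries of a quantum matrix; these entries
    enter only through it. *)
Lemma cheb_eval_diag (F : fieldType) (A : algType F) (q : F) (n : nat)
    (al de z : A) :
  q != 0 -> n.-primitive_root (q ^+ 2) ->
  z * al = q ^+ 2 *: (al * z) -> de * z = q ^+ 2 *: (z * de) ->
  de * al = 1 + q *: z -> al * de = 1 + q^-1 *: z ->
  cheb_eval n (al + de) = al ^+ n + de ^+ n.
Proof.
move=> q0; move uE: (q ^+ 2) => u hu zal dez deal alde.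
have [|n_gt1] := leqP n 1.
  case: n hu => [/prim_order_gt0 //|[|//]] _ _.
  by rewrite cheb_eval1 !expr1.
have u0 : u != 0 by rewrite -uE expf_neq0.
have zalk k := qcomm_expr k zal.
have zdek k : z * de ^+ k = u ^- k *: (de ^+ k * z).
  by rewrite -exprVn; apply: qcomm_expr; rewrite dez scalerA mulVf // scale1r.
set t := al + de; pose ev := bimul (F := F) t z.
have ev_step c P x : ev (- ((1 + c%:P%:P * 'X) * P)) x = - (ev P x + c *: (ev P x * z)).
  by rewrite /ev bimulNl mulrDl mul1r bimulDl -mulrA bimulZ bimulX.
(* The product grows on the left and carries the column (al, 1) to (al^(k+1), al^k). *)
have alE k : let M := \prod_(i < k) transfer (q * u ^+ (k.-1 - i)) in
    ev (M 0 0) al + ev (M 0 1) 1 = al ^+ k.+1 /\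
    ev (M 1 0) al + ev (M 1 1) 1 = al ^+ k.
  elim: k => [|k]; first by rewrite big_ord0 /= !mxE /= /ev !bimul0 !bimul1 addr0 add0r.
  rewrite big_ord_recl /= subn0.
  have -> : \prod_(i < k) transfer (q * u ^+ (k - bump 0 i)) =
            \prod_(i < k) transfer (q * u ^+ (k.-1 - i)).
    apply: eq_bigr => i _.
    by congr (transfer (_ * _ ^+ _)); move: (ltn_ord i); rewrite /bump /=; lia.
  set M := \prod_(_ < _) _ => -[IH0 IH1].
  rewrite !mx2M_entries !mx2E !mul1r !mul0r !addr0 IH0; split=> //.
  rewrite /ev !bimulDl !bimul_tau -/ev !mulNr !ev_step addrACA -mulrDr IH0.
  rewrite -opprD addrACA -scalerDr -mulrDl IH1 mulrDl -exprS.
  (* Since de al^(k+1) = (1 + q z) al^k, moving z to the right past al^k produces the parameter q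
     u^k. *)
  rewrite [X in de * X]exprS mulrA deal mulrDl mul1r -scalerAl zalk scalerA.
  by rewrite addrK.
(* Here the product grows on the right: at k = n the factors of [alE] and [deE]
   agree, so that adding the two expressions leaves only the trace. *)
have deE k : let M := \prod_(i < k) transfer (q^-1 * u ^- i) in
    ev (M 0 0) 1 - ev (M 1 0) al = de ^+ k /\
    ev (M 0 1) 1 - ev (M 1 1) al = - (al * de ^+ k).
  elim: k => [|k]; first by rewrite big_ord0 /= !mxE /= /ev !bimul0 !bimul1 subr0 sub0r mulr1.
  rewrite big_ord_recr /=; set M := \prod_(_ < _) _ => -[IH0 IH1].
  rewrite !mx2M_entries !mx2E !mulr1 !mulr0 !addr0.
  rewrite ![_ * 'X%:P]mulrC ![_ * - _]mulrN ![_ * (1 + _)]mulrC.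
  rewrite !ev_step /ev !bimulDl !bimul_tau -/ev; split.
    (* This is t de^k - al de^k = de^(k+1); the second component of the row keeps track of al
       de^k. *)
    rewrite opprD addrACA -mulrBr IH0 IH1 mulrDl -exprS.
    by rewrite addrAC addrN add0r.
  rewrite -opprD; congr (- _); rewrite opprD addrACA -scalerN -scalerDr -mulNr.
  rewrite -mulrDl IH0 [in RHS]exprS mulrA alde mulrDl mul1r -scalerAl zdek.
  by rewrite scalerA.
have [_ alnE] := alE n; have [denE _] := deE n.
(* The parameters agree because q^2 = u and u^n = 1. *)
have ME : \prod_(i < n) transfer (q^-1 * u ^- i) =
          \prod_(i < n) transfer (q * u ^+ (n.-1 - i)).
  apply: eq_bigr => i _; congr transfer.
  apply: (mulfI q0); apply: (mulIf (expf_neq0 i u0)).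
  rewrite mulrA mulfV // mul1r mulVf ?expf_neq0 // mulrA -expr2 uE -mulrA -exprD -exprS.
  rewrite (_ : (n.-1 - i + i).+1 = n)%N ?(prim_expr_order hu) //.
  by move: (ltn_ord i); lia.
move: denE alnE; rewrite ME; have := mxtrace_prod_transfer hu q n_gt1.
set M := \prod_(_ < _) _ => trM <- <-; rewrite [RHS]addrC addrA subrK.
rewrite /ev -bimulDl -mxtrace2 trM bimul_const rmorph_cheb /=.
by rewrite horner_algX.
Qed.

(** * Products of points of the quantum group *)

(* The relations defining the A-points of the quantum group SL_2^q. *)
Record qSL2 (F : fieldType) (A : algType F) (q : F) (al be ga de : A) : Prop :=
  QSL2 {
    qSL2_ba : be * al = q *: (al * be);
    qSL2_ca : ga * al = q *: (al * ga);
    qSL2_db : de * be = q *: (be * de);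
    qSL2_dc : de * ga = q *: (ga * de);
    qSL2_cb : ga * be = be * ga;
    qSL2_da : de * al = 1 + q *: (be * ga);
    qSL2_ad : al * de = 1 + q^-1 *: (be * ga) }.

(** Separates the entries of the two matrices in a product of two entries of M M', so that the
    relations of each matrix can be applied on their own. *)
Lemma mulrDD_comm (A : nzRingType) (x x' y y' z z' w w' : A) :
  GRing.comm x' z -> GRing.comm x' w -> GRing.comm y' z -> GRing.comm y' w ->
  (x * x' + y * y') * (z * z' + w * w') =
  x * z * (x' * z') + y * w * (y' * w') + (x * w * (x' * w') + y * z * (y' * z')).
Proof.
have ACA a a' b b' : GRing.comm a' b -> a * a' * (b * b') = a * b * (a' * b') :> A.
  by move=> ab; rewrite -!mulrA; congr (_ * _); rewrite !mulrA ab.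
move=> xz xw yz yw; rewrite mulrDl !mulrDr.
by rewrite (ACA _ _ _ _ xz) (ACA _ _ _ _ xw) (ACA _ _ _ _ yz) (ACA _ _ _ _ yw)
           [X in _ + X]addrC addrACA.
Qed.

Lemma qSL2_mul (F : fieldType) (A : algType F) (q : F)
    (a b c d a' b' c' d' : A) :
  q != 0 -> qSL2 q a b c d -> qSL2 q a' b' c' d' ->
  (forall x y, x \in [:: a; b; c; d] -> y \in [:: a'; b'; c'; d'] ->
     GRing.comm y x) ->
  qSL2 q (a * a' + b * c') (a * b' + b * d') (c * a' + d * c') (c * b' + d * d').
Proof.
move=> q0 [ba ca db dc cb da ad] [ba' ca' db' dc' cb' da' ad'] comm.
have expand x y z w x' y' z' w' :
    x \in [:: a; b; c; d] -> y \in [:: a; b; c; d] ->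
    z \in [:: a; b; c; d] -> w \in [:: a; b; c; d] ->
    x' \in [:: a'; b'; c'; d'] -> y' \in [:: a'; b'; c'; d'] ->
    (x * x' + y * y') * (z * z' + w * w') =
    x * z * (x' * z') + y * w * (y' * w') + (x * w * (x' * w') + y * z * (y' * z')).
  by move=> *; apply: mulrDD_comm; apply: comm.
(* The relations bring the quadratic words of each matrix to a common order; what remains is a
   rearrangement of sums. *)
split; rewrite !expand ?inE ?eqxx ?orbT // ?(ba, ca, db, dc, cb, da, ad) ?(ba', ca', db', dc', cb', da', ad').
all: rewrite -?scalerAl -?scalerAr ?mulrDr ?mulrDl ?mulr1 ?mul1r.
all: rewrite -?scalerAl -?scalerAr ?scalerDr ?scalerA ?mulfV ?mulVf ?scale1r //.
1-4: by congr (_ + _); rewrite addrA; congr (_ + _); apply: addrC.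
- by congr (_ + _); rewrite addrACA [X in X + _ = _]addrC addrACA.
- rewrite [RHS]addrCA; congr (_ + _); rewrite -!addrA [LHS]addrCA; congr (_ + _).
  by rewrite [RHS]addrCA; congr (_ + _); rewrite addrCA.
- rewrite [RHS]addrCA; congr (_ + _); rewrite -!addrA; congr (_ + _).
  by rewrite addrCA; congr (_ + _); rewrite addrCA.
Qed.

(** The two summands of an entry commute up to q^2: one factor q comes from a row of the first
    matrix, the other from a column of the second. Hence [exprD_qcomm] applies with u = q^2. *)
Lemma qSL2_mul_exp (F : fieldType) (A : algType F) (q : F) (n : nat)
    (a b c d a' b' c' d' : A) :
  n.-primitive_root (q ^+ 2) -> qSL2 q a b c d -> qSL2 q a' b' c' d' ->
  (forall x y, x \in [:: a; b; c; d] -> y \in [:: a'; b'; c'; d'] ->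
     GRing.comm y x) ->
  mx2 (a ^+ n) (b ^+ n) (c ^+ n) (d ^+ n) *
    mx2 (a' ^+ n) (b' ^+ n) (c' ^+ n) (d' ^+ n) =
  mx2 ((a * a' + b * c') ^+ n) ((a * b' + b * d') ^+ n)
      ((c * a' + d * c') ^+ n) ((c * b' + d * d') ^+ n).
Proof.
move=> hq [ba _ _ dc _ _ _] [_ ca' db' _ _ _ _] comm; rewrite mx2M.
have entry x y x' y' : x \in [:: a; b; c; d] -> y \in [:: a; b; c; d] ->
    x' \in [:: a'; b'; c'; d'] -> y' \in [:: a'; b'; c'; d'] ->
    y * x = q *: (x * y) -> y' * x' = q *: (x' * y') ->
    x ^+ n * x' ^+ n + y ^+ n * y' ^+ n = (x * x' + y * y') ^+ n.
  move=> hx hy hx' hy' yx yx'.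
  rewrite (exprD_qcomm hq).
    by rewrite !exprMn_comm //; apply/commr_sym/comm.
  rewrite -mulrA [y' * _]mulrA (comm _ _ hx hy') -!mulrA yx' mulrA yx.
  rewrite -scalerAl -!scalerAr scalerA -expr2 -!mulrA; congr (_ *: (_ * _)).
  by rewrite !mulrA (comm _ _ hy hx').
by congr mx2; apply: entry; rewrite ?inE ?eqxx ?orbT.
Qed.

(** The product of the off-diagonal entries is 0, so the last two relations reduce to
    [mutually_inverse]; multiplying b a = q a b by a' on both sides gives the relation between a'
    and b. *)
Lemma qSL2_triang (F : fieldType) (A : algType F) (q : F) (up : bool)
    (a a' b : A) :
  q != 0 -> mutually_inverse a a' -> b * a = q *: (a * b) ->
  qSL2 q a (if up then b else 0) (if up then 0 else b) a'.
Proof.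
move=> q0 [aa' a'a] ba.
have a'b : a' * b = q *: (b * a').
  have := congr1 (fun x => a' * x * a') ba.
  by rewrite -scalerAr -scalerAl !mulrA a'a mul1r -!mulrA aa' mulr1.
by case: up; split; rewrite ?(mulr0, mul0r, scaler0, addr0).
Qed.

Lemma comm_mutually_inverse (A : nzRingType) (x a a' : A) :
  mutually_inverse a a' -> GRing.comm x a -> GRing.comm x a'.
Proof.
move=> [aa' a'a] xa; rewrite /GRing.comm -[LHS]mul1r -a'a -mulrA [a * _]mulrA -xa.
by rewrite -!mulrA aa' mulr1.
Qed.

Lemma triangE (A : nzRingType) (up : bool) (a a' b : A) :
  triang up a a' b = mx2 a (if up then b else 0) (if up then 0 else b) a'.
Proof. by case: up. Qed.

(** The last clause strengthens the induction: it makes the entries of a partial product commute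
    with those of the next factor. *)
Lemma qSL2_prod_triang (F : fieldType) (A : algType F) (q : F) (n k : nat)
    (up : 'I_k -> bool) (a a' b : 'I_k -> A) :
  q != 0 -> n.-primitive_root (q ^+ 2) ->
  (forall i, mutually_inverse (a i) (a' i)) ->
  (forall i, b i * a i = q *: (a i * b i)) ->
  (forall i j, i != j ->
     [/\ GRing.comm (a i) (a j), GRing.comm (a i) (b j),
         GRing.comm (b i) (a j) & GRing.comm (b i) (b j)]) ->
  exists al be ga de : A,
    [/\ \prod_(i < k) triang (up i) (a i) (a' i) (b i) = mx2 al be ga de,
        \prod_(i < k) triang (up i) (a i ^+ n) (a' i ^+ n) (b i ^+ n) =
          mx2 (al ^+ n) (be ^+ n) (ga ^+ n) (de ^+ n),
        qSL2 q al be ga de &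
        forall x, (forall i, GRing.comm x (a i) /\ GRing.comm x (b i)) ->
          forall y, y \in [:: al; be; ga; de] -> GRing.comm x y].
Proof.
move=> q0 hq; have n_gt0 := prim_order_gt0 hq.
(* As n > 0, the zero entries of triangular and identity matrices survive the n-th power. *)
have zn : 0 ^+ n = 0 :> A by rewrite expr0n gtn_eqF.
elim: k up a a' b => [|k IH] up a a' b aV ba ab.
  exists 1, 0, 0, 1; rewrite !big_ord0 zn expr1n -mx2_1; split=> //.
    by split; rewrite ?(mulr0, mul0r, mulr1, scaler0, addr0).
  move=> x _ y; rewrite !inE.
  by case/or4P => /eqP ->; rewrite /GRing.comm ?(mulr1, mul1r, mulr0, mul0r).
pose w := widen_ord (leqnSn k).
have [|||al [be [ga [de [E En qM cM]]]]] :=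
    IH (up \o w) (a \o w) (a' \o w) (b \o w).
- by move=> i; apply: aV.
- by move=> i; apply: ba.
- by move=> i j ij; apply: ab.
pose m : 'I_k.+1 := ord_max.
pose bu := if up m then b m else 0; pose bl := if up m then 0 else b m.
have qT : qSL2 q (a m) bu bl (a' m) by apply: qSL2_triang.
have commT x : GRing.comm x (a m) -> GRing.comm x (b m) ->
    forall z, z \in [:: a m; bu; bl; a' m] -> GRing.comm x z.
  move=> xa xb z; rewrite !inE /bu /bl => /or4P[] /eqP ->.
  - exact: xa.
  - by case: ifP => _; [exact: xb | exact: commr0].
  - by case: ifP => _; [exact: commr0 | exact: xb].
  - exact: comm_mutually_inverse (aV m) xa.
have cT x y : x \in [:: al; be; ga; de] -> y \in [:: a m; bu; bl; a' m] ->
    GRing.comm y x.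
  have wm i : m != w i by rewrite -val_eqE /= gtn_eqF.
  move=> hx hy; apply: commr_sym; apply: (commT x) hy; apply: commr_sym.
  - by apply: cM hx => i; case: (ab _ _ (wm i)).
  - by apply: cM hx => i; case: (ab _ _ (wm i)).
exists (al * a m + be * bl), (al * bu + be * a' m),
       (ga * a m + de * bl), (ga * bu + de * a' m).
split.
- by rewrite big_ord_recr /= [X in X * _]E triangE mx2M.
- rewrite big_ord_recr /= [X in X * _]En triangE -(qSL2_mul_exp hq qM qT cT).
  by rewrite /bu /bl; case: (up m); rewrite ?zn.
- exact: qSL2_mul.
move=> x cx y.
have cxM z : z \in [:: al; be; ga; de] -> GRing.comm x z by apply: cM => i; apply: cx.
have cxT := commT x (cx m).1 (cx m).2.
rewrite !inE => /or4P[] /eqP ->; apply: commrD; apply: commrM.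
all: first [by apply: cxM; rewrite !inE eqxx ?orbT | by apply: cxT; rewrite !inE eqxx ?orbT].
Qed.

Theorem theorem1 (R : realType) (A : algType R[i]) (q : R[i]) (hq : q != 0)
  (k : nat) (upper : 'I_k -> bool) (a a' b : 'I_k -> A)
  (ha : forall i, mutually_inverse (a i) (a' i))
  (hba : forall i, b i * a i = q *: (a i * b i))
  (hcomm : forall i j, i != j ->
     [/\ GRing.comm (a i) (a j), GRing.comm (a i) (b j),
         GRing.comm (b i) (a j) & GRing.comm (b i) (b j)])
  (n : nat) (hn : n.-primitive_root (q ^+ 2)) :
  cheb_eval n (\tr (\prod_(i < k) triang (upper i) (a i) (a' i) (b i))) =
  \tr (\prod_(i < k) triang (upper i) (a i ^+ n) (a' i ^+ n) (b i ^+ n)).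
Proof.
have [al [be [ga [de [-> -> [ba ca db dc cb da ad] _]]]]] :=
  qSL2_prod_triang upper hq hn ha hba hcomm.
rewrite !mxtrace_mx2; apply: (@cheb_eval_diag _ A q n al de (be * ga)) => //.
- by rewrite -mulrA ca -scalerAr [be * (al * _)]mulrA ba -scalerAl scalerA -expr2 mulrA.
- by rewrite [LHS]mulrA db -scalerAl -[be * de * _]mulrA dc -scalerAr scalerA -expr2 mulrA.
Qed.
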